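(* For any $\beta>0$, $\mu>0$ and $\alpha\in(0,1)$, there exist values $\gamma>0$ and $\epsilon>0$ satisfying the condition $$\begin{cases}\frac{\beta\gamma^2}{4}<\epsilon<\frac{\beta\gamma^2}{2},\\[2pt] \epsilon>\frac{\beta\gamma^2}{2}-\left(\frac{\alpha\gamma\mu}{2}-\frac{(1-\alpha)\mu^2}{2\beta}\right),\\[2pt] \gamma>\frac{(1-\alpha)\mu}{\alpha\beta}.\end{cases}\qquad(\ast)$$ Moreover, for all parameters $\beta,\mu,\gamma,\epsilon>0$, $\alpha\in(0,1)$ satisfying $(\ast)$, a common quadratic Lyapunov function exists for the dynamic system $$\begin{cases}x'(t)=-\gamma y'(t)-\epsilon y(t),\\ y'(t)=\beta x(t)+\frac12\alpha\mu\,(w(t)-|y(t)|),\\ w'(t)=\beta x(t)+\frac12(\alpha-2)\mu\,(w(t)-|y(t)|),\end{cases}\qquad (x(t),y(t),w(t))\in\mathbb{R}^3,$$ and this system is exponentially stable.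
   Context: With $u(t)=(x(t),y(t),w(t))^T$, the dynamic system in the claim is a switched linear system: $u'(t)=A^+u(t)$ when $y(t)\ge 0$ and $u'(t)=A^-u(t)$ when $y(t)<0$, where $$A^{+}=\begin{pmatrix}-\gamma\beta & \frac12\gamma\alpha\mu-\epsilon & -\frac12\gamma\alpha\mu\\ \beta & -\frac12\alpha\mu & \frac12\alpha\mu\\ \beta & -\frac12(\alpha-2)\mu & \frac12(\alpha-2)\mu\end{pmatrix},\qquad A^{-}=\begin{pmatrix}-\gamma\beta & -\frac12\gamma\alpha\mu-\epsilon & -\frac12\gamma\alpha\mu\\ \beta & \frac12\alpha\mu & \frac12\alpha\mu\\ \beta & \frac12(\alpha-2)\mu & \frac12(\alpha-2)\mu\end{pmatrix}.$$ A function $V(u)=u^TPu$ is a quadratic Lyapunov function for a linear system $u'(t)=Au(t)$ if $P$ is a real symmetric positive definite matrix and $PA+A^TP$ is negative definite. A common quadratic Lyapunov function of the dynamic system in the claim is a function $V(u)=u^TPu$ that is a quadratic Lyapunov function for both $u'(t)=A^+u(t)$ and $u'(t)=A^-u(t)$. The system is exponentially stable if the origin is an exponentially stable equilibrium, i.e. there exist real constants $C>0$, $a>0$ such that $\|u(t)\|\le Ce^{-at}\|u(0)\|$ for all $t\ge0$ and all solutions $u(\cdot)$ of the system, where $\|\cdot\|$ is the Euclidean norm. *)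

(* Defs.v *)
From mathcomp Require Import all_boot all_order all_algebra.
From mathcomp Require Import classical_sets reals topology normedtype.
From mathcomp Require Import sequences derive realfun.
From mathcomp Require Import ring.

Set Implicit Arguments.
Unset Strict Implicit.
Unset Printing Implicit Defensive.

Import Order.TTheory GRing.Theory Num.Theory.
Import numFieldNormedType.Exports.

Local Open Scope ring_scope.

Definition mx3 (R : realType) (s : seq (seq R)) : 'M[R]_3 :=
  \matrix_(i < 3, j < 3) (nth [::] s i)`_j.

Definition vec3 (R : realType) (x y w : R) : 'cV[R]_3 :=
  \col_(i < 3) [:: x; y; w]`_i.

(* MathComp-Analysis's norm [`|u|] on matrices is the max norm. *)
Definition euclidean_norm (R : realType) n (u : 'cV[R]_n) : R :=
  Num.sqrt (\sum_(i < n) u i 0 ^+ 2).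

Definition quadratic_form (R : realType) n (M : 'M[R]_n) (u : 'cV[R]_n) : R :=
  (u^T *m M *m u) 0 0.

Definition positive_definite (R : realType) n (M : 'M[R]_n) : Prop :=
  forall u : 'cV[R]_n, u != 0 -> 0 < quadratic_form M u.

Definition negative_definite (R : realType) n (M : 'M[R]_n) : Prop :=
  forall u : 'cV[R]_n, u != 0 -> quadratic_form M u < 0.

Definition quadratic_lyapunov (R : realType) n (A : 'M[R]_n)
    (V : 'cV[R]_n -> R) : Prop :=
  exists P : 'M[R]_n,
    [/\ P^T = P, positive_definite P,
        negative_definite (P *m A + A^T *m P) &
        forall u, V u = quadratic_form P u].

Definition Aplus (R : realType) (alpha beta mu gamma eps : R) : 'M[R]_3 :=
  mx3 [:: [:: - (gamma * beta);
              2^-1 * gamma * alpha * mu - eps;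
              - (2^-1 * gamma * alpha * mu)];
          [:: beta;
              - (2^-1 * alpha * mu);
              2^-1 * alpha * mu];
          [:: beta;
              - (2^-1 * (alpha - 2) * mu);
              2^-1 * (alpha - 2) * mu]].

Definition Aminus (R : realType) (alpha beta mu gamma eps : R) : 'M[R]_3 :=
  mx3 [:: [:: - (gamma * beta);
              - (2^-1 * gamma * alpha * mu) - eps;
              - (2^-1 * gamma * alpha * mu)];
          [:: beta;
              2^-1 * alpha * mu;
              2^-1 * alpha * mu];
          [:: beta;
              2^-1 * (alpha - 2) * mu;
              2^-1 * (alpha - 2) * mu]].

Definition has_common_quadratic_lyapunov (R : realType)
    (alpha beta mu gamma eps : R) : Prop :=
  exists V : 'cV[R]_3 -> R,
    quadratic_lyapunov (Aplus alpha beta mu gamma eps) V /\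
    quadratic_lyapunov (Aminus alpha beta mu gamma eps) V.

(* [dx], [dy], [dw] stand for the values of the derivatives. *)
Definition system_eqs (R : realType) (alpha beta mu gamma eps : R)
    (x y w dx dy dw : R) : Prop :=
  [/\ dx = - gamma * dy - eps * y,
      dy = beta * x + 2^-1 * alpha * mu * (w - `|y|) &
      dw = beta * x + 2^-1 * (alpha - 2) * mu * (w - `|y|)].

(* Solutions on the half-line [0, +oo[.  The trajectories are functions on the
   whole of R, but only their values on [0, +oo[ matter: differentiability is
   required on ]0, +oo[ and right-continuity at 0.  Since the right-hand side
   is continuous, the mean value theorem then gives one-sided derivatives at 0
   satisfying the same equations, so that this is the class of functions that
   are differentiable (from the right at 0) and solve the system on
   [0, +oo[. *)
Definition is_solution (R : realType) (alpha beta mu gamma eps : R)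
    (x y w : R -> R) : Prop :=
  [/\ derivable_oy_Rcontinuous x 0,
      derivable_oy_Rcontinuous y 0,
      derivable_oy_Rcontinuous w 0 &
      forall t : R, 0 < t ->
        system_eqs alpha beta mu gamma eps
          (x t) (y t) (w t) (x^`()%classic t) (y^`()%classic t) (w^`()%classic t)].

Definition exponentially_stable (R : realType)
    (alpha beta mu gamma eps : R) : Prop :=
  exists C a : R,
    [/\ 0 < C, 0 < a &
        forall x y w : R -> R,
          is_solution alpha beta mu gamma eps x y w ->
          forall t : R, 0 <= t ->
            euclidean_norm (vec3 (x t) (y t) (w t)) <=
            C * expR (- a * t) * euclidean_norm (vec3 (x 0) (y 0) (w 0))].

Definition parameter_condition (R : realType)
    (alpha beta mu gamma eps : R) : Prop :=
  [/\ beta * gamma ^+ 2 / 4 < eps < beta * gamma ^+ 2 / 2,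
      beta * gamma ^+ 2 / 2
        - (alpha * gamma * mu / 2 - (1 - alpha) * mu ^+ 2 / (2 * beta)) < eps &
      (1 - alpha) * mu / (alpha * beta) < gamma].

(* The system is the switched linear system with modes [Aplus] and [Aminus]. *)
Lemma system_eqs_switched (R : realType) (alpha beta mu gamma eps : R)
    (x y w dx dy dw : R) :
  system_eqs alpha beta mu gamma eps x y w dx dy dw <->
  vec3 dx dy dw =
    (if 0 <= y then Aplus alpha beta mu gamma eps
     else Aminus alpha beta mu gamma eps) *m vec3 x y w.
Proof.
have vec3P (a b c : R) (v : 'cV[R]_3) :
    vec3 a b c = v <->
    [/\ a = v 0 0, b = v (inord 1) 0 & c = v (inord 2) 0].
  split=> [<-|[-> -> ->]]; first by rewrite !mxE /= !inordK.
  apply/matrixP => i j; rewrite !mxE (ord1 j).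
  by case: i => -[|[|[|//]]] Hi /=; congr (v _ 0); apply/val_inj;
    rewrite /= ?inordK.
rewrite vec3P /system_eqs.
have [y0|y0] := lerP 0 y; rewrite ?(ger0_norm y0) ?(ltr0_norm y0);
  rewrite !mxE !big_ord_recl !big_ord0 !mxE /= !inordK //=;
  by split=> -[-> -> ->]; split=> //; field.
Qed.

(* Main.v *)
(* The system is a Lur'e system driven by the sector nonlinearity [- |y|], and
   a common quadratic Lyapunov function amounts to the strict circle criterion.
   With [k = alpha mu / 2], the transfer function from [- |y|] to [y] is
   [k s^2 / (s^3 + p s^2 + q s + r)], where [p = beta gamma + mu - k],
   [q = beta eps + beta gamma mu], [r = beta eps mu], and the criterion says
   that [|r - p w^2 + i w (q - w^2)|^2 - k^2 w^4 > 0] at every real frequency [w].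
   The left-hand side is [w^2 (n - w^2)^2 + d2 w^4 + d1 w^2 + r^2] with
   [n = alpha beta gamma mu / 2], where [d2], [d1] are positive as soon as
   [eps < beta gamma^2 / 2].  This decomposition turns into an explicit
   quadratic form whose derivative along either mode is minus a sum of squares.
   Exponential stability follows by comparing the form and its derivative with
   the squared norm, by compactness of the unit sphere. *)
Require Import Defs.
From mathcomp Require Import all_boot all_order all_algebra.
From mathcomp Require Import classical_sets reals topology normedtype.
From mathcomp Require Import sequences derive realfun.
From mathcomp Require Import boolp functions exp ring lra.

Import Order.TTheory GRing.Theory Num.Theory.
Import numFieldNormedType.Exports.

Local Open Scope ring_scope.

(** * Quadratic forms and their comparison with the squared norm *)

Lemma bilinear_formE (R : realType) n (M : 'M[R]_n) (u v : 'cV[R]_n) :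
  (u^T *m M *m v) 0 0 = \sum_i \sum_j M i j * (u i 0 * v j 0).
Proof.
rewrite mxE exchange_big; apply: eq_bigr => j _ /=.
rewrite mxE mulr_suml; apply: eq_bigr => i _; rewrite mxE.
by rewrite mulrCA mulrA.
Qed.

Lemma quadratic_formE (R : realType) n (M : 'M[R]_n) (u : 'cV[R]_n) :
  quadratic_form M u = \sum_i \sum_j M i j * (u i 0 * u j 0).
Proof. exact: bilinear_formE. Qed.

Lemma quadratic_formZ (R : realType) n (M : 'M[R]_n) (a : R) (u : 'cV[R]_n) :
  quadratic_form M (a *: u) = a ^+ 2 * quadratic_form M u.
Proof.
rewrite !quadratic_formE mulr_sumr; apply: eq_bigr => i _; rewrite mulr_sumr.
by apply: eq_bigr => j _; rewrite !mxE; ring.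
Qed.

Lemma quadratic_formN (R : realType) n (M : 'M[R]_n) (u : 'cV[R]_n) :
  quadratic_form (- M) u = - quadratic_form M u.
Proof. by rewrite /quadratic_form mulmxN mulNmx mxE. Qed.

Lemma quadratic_form0 (R : realType) n (M : 'M[R]_n) : quadratic_form M 0 = 0.
Proof. by rewrite /quadratic_form mulmx0 mxE. Qed.

Lemma sumsq_eq0 (R : realType) n (u : 'cV[R]_n) :
  (\sum_i u i 0 ^+ 2 == 0) = (u == 0).
Proof.
apply/idP/eqP => [|->]; last by rewrite big1// => i _; rewrite mxE expr0n.
rewrite psumr_eq0 => [/allP u0|i _]; last exact: sqr_ge0.
apply/colP => i; rewrite mxE; apply/eqP; rewrite -sqrf_eq0.
by apply: (implyP (u0 i _)); rewrite ?mem_index_enum.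
Qed.

(** The filter is arbitrary so that the lemma serves both for continuity on the unit sphere and for
    right-continuity of trajectories at 0. *)
Lemma cvg_quadratic_form (R : realType) n (M : 'M[R]_n) (T : Type)
    (F : set_system T) {FF : Filter F} (u : T -> 'cV[R]_n) (l : 'cV[R]_n) :
  (forall i, u t i 0 @[t --> F] --> l i 0)%classic ->
  (quadratic_form M (u t) @[t --> F] --> quadratic_form M l)%classic.
Proof.
move=> ul; rewrite quadratic_formE; under eq_fun do rewrite quadratic_formE.
apply: cvg_big => [|i _]; first exact: add_continuous.
apply: cvg_big => [|j _]; first exact: add_continuous.
by apply: cvgM; [exact: cvg_cst|apply: cvgM; exact: ul].
Qed.

(** Each product [u i 0 * u j 0] is bounded in absolute value by the squared norm, since
    [(u i 0 - u j 0) ^+ 2] and [(u i 0 + u j 0) ^+ 2] are nonnegative. The summand 1 in the witness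
    keeps the constant positive. *)
Lemma quadratic_form_le (R : realType) n (M : 'M[R]_n) :
  exists2 C, 0 < C &
    forall u, quadratic_form M u <= C * \sum_i u i 0 ^+ 2.
Proof.
exists (1 + \sum_i \sum_j `|M i j|) => [|u].
  by rewrite ltr_pwDl// sumr_ge0// => i _; rewrite sumr_ge0.
set s := \sum_i u i 0 ^+ 2.
have s0 : 0 <= s by rewrite sumr_ge0// => i _; exact: sqr_ge0.
have us i : u i 0 ^+ 2 <= s.
  by rewrite /s (bigD1 i)//= lerDl sumr_ge0// => j _; exact: sqr_ge0.
rewrite mulrDl mul1r quadratic_formE -[leLHS]add0r lerD//.
rewrite mulr_suml ler_sum// => i _; rewrite mulr_suml ler_sum// => j _.
rewrite (le_trans (ler_norm _))// normrM ler_wpM2l//.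
have := us i; have := us j; have := sqr_ge0 (u i 0 + u j 0).
have := sqr_ge0 (u i 0 - u j 0); rewrite sqrrB sqrrD ler_norml; lra.
Qed.

(** The constant is the minimum of the form on the compact unit sphere; homogeneity of degree two
    extends the bound to all vectors. *)
Lemma positive_definite_coercive (R : realType) n (M : 'M[R]_n) :
  positive_definite M ->
  exists2 c, 0 < c &
    forall u : 'cV[R]_n, c * \sum_i u i 0 ^+ 2 <= quadratic_form M u.
Proof.
move=> Mpos.
(* The sphere is made of row vectors to match [EVT_min_rV]. *)
pose S := [set v : 'rV[R]_n | \sum_i v 0 i ^+ 2 = 1]%classic.
have Ssphere (u : 'cV[R]_n) : u != 0 ->
    S ((Num.sqrt (\sum_i u i 0 ^+ 2))^-1 *: u^T).
  move=> u0; rewrite /S /=.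
  set s := (\sum_i u i 0 ^+ 2).
  have s0 : 0 <= s by rewrite sumr_ge0// => i _; exact: sqr_ge0.
  under eq_bigr do rewrite !mxE exprMn exprVn sqr_sqrtr//.
  by rewrite -mulr_sumr mulVf// sumsq_eq0.
(* If the sphere is empty, no nonzero vector exists (dimension zero) and any constant works. *)
have [[v0 Sv0]|S0] := pselect (S !=set0)%classic; last first.
  exists 1 => // u; have [->|u0] := eqVneq u 0.
    rewrite quadratic_form0 big1 ?mulr0// => i _.
    by rewrite mxE expr0n.
  by case: S0; eexists; exact: Ssphere u0.
have coordc i : continuous (fun v : 'rV[R]_n => v 0 i : R).
  exact: coord_continuous.
have Sc : compact S.
  apply: bounded_closed_compact.
    exists 1; split=> // x x1 v /= Sv; apply: le_trans (ltW x1).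
    have vi i : `|v 0 i| <= 1.
      rewrite -(@expr_le1 _ 2)// real_normK ?num_real// -Sv (bigD1 i)//= lerDl.
      by rewrite sumr_ge0// => j _; exact: sqr_ge0.
    rewrite [leLHS]/Num.norm /= mx_normrE.
    apply/bigmax_leP; split=> // -[i j] _ /=.
    by rewrite (ord1 i).
  pose g (v : 'rV[R]_n) := \sum_i v 0 i ^+ 2.
  have gc : continuous g.
    apply: continuous_big => [|i _]; first exact: add_continuous.
    by move=> v; exact: cvgM (coordc i v) (coordc i v).
  rewrite (_ : S = g @^-1` [set 1])%classic//.
  by apply: closed_comp => [v _|]; [exact: gc|exact: closed_eq].
pose f (v : 'rV[R]_n) := quadratic_form M v^T.
have fc : continuous f.
  move=> v; apply: (@cvg_quadratic_form R n M _ _ (nbhs_filter v) trmx) => i.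
  rewrite mxE.
  by under eq_fun do rewrite mxE; exact: coordc.
have [|w] := @EVT_min_rV R n f S (ex_intro _ v0 Sv0) Sc.
  exact: continuous_subspaceT.
rewrite inE => Sw wmin; exists (f w) => [|u].
  apply: Mpos; apply: contra_eq_neq Sw => /(congr1 trmx).
  rewrite trmxK trmx0 => ->; rewrite big1 1?eq_sym ?oner_eq0// => i _.
  by rewrite mxE expr0n.
have [->|u0] := eqVneq u 0.
  by rewrite quadratic_form0 big1 ?mulr0// => i _; rewrite mxE expr0n.
set s := \sum_i u i 0 ^+ 2.
have s0 : 0 < s.
  by rewrite lt_def sumsq_eq0 u0 sumr_ge0// => i _; exact: sqr_ge0.
have := wmin _ (mem_set (Ssphere _ u0)).
rewrite -linearZ /f /= trmxK quadratic_formZ exprVn sqr_sqrtr ?(ltW s0)//.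
by rewrite ler_pdivlMl// mulrC.
Qed.

Lemma negative_definite_coercive (R : realType) n (M : 'M[R]_n) :
  negative_definite M ->
  exists2 c, 0 < c &
    forall u : 'cV[R]_n, quadratic_form M u <= - c * \sum_i u i 0 ^+ 2.
Proof.
move=> Mneg; have [|c c0 cM] := @positive_definite_coercive R n (- M).
  by move=> u /Mneg; rewrite quadratic_formN oppr_gt0.
by exists c => // u; rewrite mulNr lerNr -quadratic_formN.
Qed.

(** * Exponential decay from a Lyapunov function *)

(** Gronwall argument: the product of [f] with the integrating factor [expR (a * t)] is
    nonincreasing. *)
Lemma exponential_decay (R : realType) (f : R -> R) (a : R) :
  derivable_oy_Rcontinuous f 0 ->
  (forall t : R, 0 < t -> f^`()%classic t <= - a * f t) ->
  forall t : R, 0 <= t -> f t <= expR (- a * t) * f 0.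
Proof.
move=> fd df t t0.
have fc := derivable_oy_Rcontinuous_within_itvcy fd.
pose g s := expR (a * s) * f s.
have dg (s : R) : 0 < s ->
    is_derive s 1 g (expR (a * s) * (f^`()%classic s + a * f s)).
  move=> s0; have fs : is_derive s 1 f (f^`()%classic s).
    by rewrite derive1E; apply/derivableP/fd.1; rewrite in_itv/= s0.
  rewrite /g.
  apply: is_derive_eq.
  rewrite /GRing.scale /=; ring.
(* The derivative is controlled on the open half-line only; continuity up to 0 lets monotonicity
   include the initial time. *)
have gc : {within `[0, +oo[, continuous g}%classic.
  move=> s; apply: cvgM; last exact: fc.
  apply: continuous_subspaceT => z; apply: continuous_comp.
    exact: mulrl_continuous.
  exact: continuous_expR.
have g0 : g t <= g 0.
  apply: (@ler0_derive1_le_cc R g 0 t); rewrite ?in_itv/= ?lexx ?t0//.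
  - by move=> s; rewrite in_itv/= => /andP[s0 _]; have [] := dg s s0.
  - move=> s; rewrite in_itv/= => /andP[s0 _]; rewrite derive1E.
    have [_ ->] := dg s s0; rewrite pmulr_rle0 ?expR_gt0//.
    have := df s s0; lra.
  - apply/(continuous_subspaceW _ gc) => s /=.
    by rewrite !in_itv/= => /andP[->].
move: g0; rewrite /g mulr0 expR0 mul1r mulNr expRN => g0.
by rewrite ler_pdivlMl ?expR_gt0.
Qed.

Lemma is_derive_quadratic_form (R : realType) n (P : 'M[R]_n)
    (u : R -> 'cV[R]_n) (v : 'cV[R]_n) (t : R) :
  (forall i, is_derive t 1 (fun s => u s i 0) (v i 0)) ->
  is_derive t 1 (fun s => quadratic_form P (u s))
    (((u t)^T *m P *m v + v^T *m P *m u t) 0 0).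
Proof.
move=> du.
have -> : (fun s => quadratic_form P (u s)) =
    \sum_i \sum_j (fun s => P i j * (u s i 0 * u s j 0)).
  apply/funext => s; rewrite quadratic_formE fct_sumE; apply: eq_bigr => i _.
  by rewrite fct_sumE.
apply: is_derive_eq.
rewrite [RHS]mxE !bilinear_formE -big_split; apply: eq_bigr => i _ /=.
rewrite -big_split; apply: eq_bigr => j _ /=.
rewrite /GRing.scale /=; ring.
Qed.

Lemma quadratic_form_lyapunov (R : realType) n (P A : 'M[R]_n) (u : 'cV[R]_n) :
  quadratic_form (P *m A + A^T *m P) u =
  (u^T *m P *m (A *m u) + (A *m u)^T *m P *m u) 0 0.
Proof. by rewrite /quadratic_form trmx_mul mulmxDr mulmxDl !mulmxA. Qed.

Lemma derivable_oy_quadratic_form (R : realType) n (P : 'M[R]_n)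
    (u : R -> 'cV[R]_n) (a : R) :
  (forall i, derivable_oy_Rcontinuous (fun s => u s i 0) a) ->
  derivable_oy_Rcontinuous (fun s => quadratic_form P (u s)) a.
Proof.
move=> du; split=> [t ta|]; last first.
  by apply: cvg_quadratic_form => i; exact: (du i).2.
pose v := \col_i 'D_1 (fun s => u s i 0) t.
have [|//] := @is_derive_quadratic_form R n P u v t.
by move=> i; rewrite mxE; apply/derivableP/(du i).1.
Qed.

(** The derivative is at most [- c] times the squared norm, and [V] is at most [C] times it, whence
    the rate [c / C]. The bound is stated at a single instant, so that it applies whenever a
    switched trajectory is in this mode. *)
Lemma quadratic_lyapunov_derive_le (R : realType) n (A : 'M[R]_n)
    (V : 'cV[R]_n -> R) :
  quadratic_lyapunov A V ->
  exists2 c, 0 < c & forall (u : R -> 'cV[R]_n) (t : R),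
    (forall i, is_derive t 1 (fun s => u s i 0) ((A *m u t) i 0)) ->
    (V \o u)^`()%classic t <= - c * V (u t).
Proof.
move=> [P [_ _ neg VP]].
have [c c0 cP] := negative_definite_coercive _ _ _ neg.
have [C C0 CP] := quadratic_form_le _ _ P.
exists (c / C) => [|u t du]; first exact: divr_gt0.
rewrite (_ : V \o u = fun s => quadratic_form P (u s)); last first.
  by apply/funext => s /=.
rewrite derive1E; have [_ ->] := is_derive_quadratic_form _ _ P _ _ _ du.
rewrite -quadratic_form_lyapunov (le_trans (cP _))// VP !mulNr lerN2 mulrAC.
by rewrite ler_pdivrMr// -mulrA (ler_pM2l c0) mulrC.
Qed.

(** Sharing [V] between the modes makes the decay insensitive to switching: the matrix may change
    arbitrarily with time, and the smaller of the two rates is valid throughout. *)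
Lemma common_lyapunov_exponential_decay (R : realType) n (A B : 'M[R]_n)
    (V : 'cV[R]_n -> R) :
  quadratic_lyapunov A V -> quadratic_lyapunov B V ->
  exists C a : R, [/\ 0 < C, 0 < a &
    forall u : R -> 'cV[R]_n,
      (forall i, derivable_oy_Rcontinuous (fun s => u s i 0) 0) ->
      (forall t : R, 0 < t -> exists2 M, M = A \/ M = B &
        forall i, (fun s => u s i 0)^`()%classic t = (M *m u t) i 0) ->
      forall t : R, 0 <= t ->
        euclidean_norm (u t) <= C * expR (- a * t) * euclidean_norm (u 0)].
Proof.
move=> VA VB.
have [P [_ pos _ VP]] := VA.
have [c c0 cP] := positive_definite_coercive _ _ _ pos.
have [C C0 CP] := quadratic_form_le _ _ P.
have [a a0 aA] := quadratic_lyapunov_derive_le _ _ _ _ VA.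
have [b b0 bB] := quadratic_lyapunov_derive_le _ _ _ _ VB.
pose m := Num.min a b.
have m0 : 0 < m by rewrite lt_min a0.
(* [V] is comparable to the squared norm, with constants [c] and [C], and decays at rate [m]; taking
   square roots gives both witnesses. *)
exists (Num.sqrt (C / c)), (m / 2); split => [||u du ode t t0].
- by rewrite sqrtr_gt0 divr_gt0.
- by rewrite divr_gt0.
have V0 s : 0 <= V (u s).
  rewrite VP (le_trans _ (cP _))// mulr_ge0 ?(ltW c0)// sumr_ge0// => i _.
  exact: sqr_ge0.
have VE : V \o u = fun s => quadratic_form P (u s).
  by apply/funext => s /=.
have decay : V (u t) <= expR (- m * t) * V (u 0).
  apply: (exponential_decay _ (V \o u)) => // [|s s0].
    by rewrite VE; exact: derivable_oy_quadratic_form.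
  have [M MAB dM] := ode s s0.
  have {}dM i : is_derive s 1 (fun s => u s i 0) ((M *m u s) i 0).
    by rewrite -dM derive1E; apply/derivableP/(du i).1; rewrite in_itv/= s0.
  have mV d : m <= d -> - d * V (u s) <= - m * V (u s).
    by move=> md; rewrite ler_wpM2r// lerN2.
  case: MAB dM => -> dM.
    by apply: (le_trans (aA _ _ dM)); apply: mV; rewrite ge_min lexx.
  by apply: (le_trans (bB _ _ dM)); apply: mV; rewrite ge_min lexx orbT.
have -> : expR (- (m / 2) * t) = Num.sqrt (expR (- m * t)).
  rewrite -[LHS]ger0_norm ?expR_ge0// -sqrtr_sqr -expRM_natl.
  by congr (Num.sqrt (expR _)); field.
rewrite /euclidean_norm -!sqrtrM ?mulr_ge0 ?expR_ge0 ?invr_ge0 ?(ltW C0)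
  ?(ltW c0)//.
apply: ler_wsqrtr.
rewrite -(ler_pM2l c0) (le_trans (cP _))// -VP (le_trans decay)//.
rewrite [leRHS](_ : _ = expR (- m * t) * (C * \sum_i u 0 i 0 ^+ 2)); last first.
  by field; rewrite gt_eqF.
by rewrite ler_wpM2l ?expR_ge0// VP.
Qed.

(** * Explicit computations in dimension three *)

Lemma mx3_mul_vec3 (R : realType) (a b c d e f g h i x y z : R) :
  mx3 [:: [:: a; b; c]; [:: d; e; f]; [:: g; h; i]] *m vec3 x y z =
  vec3 (a * x + b * y + c * z) (d * x + e * y + f * z) (g * x + h * y + i * z).
Proof.
apply/colP => j; rewrite !mxE !big_ord_recl big_ord0 !mxE /= addr0.
by case: j => -[|[|[|//]]] ? /=; rewrite addrA.
Qed.

Lemma vec3_dot (R : realType) (a b c x y z : R) :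
  ((vec3 a b c)^T *m vec3 x y z) 0 0 = a * x + b * y + c * z.
Proof. by rewrite !mxE !big_ord_recl big_ord0 !mxE /= addr0 addrA. Qed.

Lemma vec3P (R : realType) (u : 'cV[R]_3) : exists x y z, u = vec3 x y z.
Proof.
exists (u 0 0), (u (inord 1) 0), (u (inord 2) 0); apply/colP => j; rewrite mxE.
by case: j => -[|[|[|//]]] ? /=; congr (u _ 0); apply/val_inj;
  rewrite /= ?inordK.
Qed.

Lemma vec3_eq0 (R : realType) (x y z : R) :
  (vec3 x y z == 0) = [&& x == 0, y == 0 & z == 0].
Proof.
apply/eqP/and3P => [/colP v0|[/eqP -> /eqP -> /eqP ->]].
  have := v0 0; have := v0 (inord 1); have := v0 (inord 2).
  by rewrite !mxE /= !inordK//= => -> -> ->.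
by apply/colP => j; rewrite !mxE; case: j => -[|[|[|//]]].
Qed.

Lemma quadratic_form_vec3 (R : realType) (a b c d e f g h i x y z : R) :
  quadratic_form (mx3 [:: [:: a; b; c]; [:: d; e; f]; [:: g; h; i]])
    (vec3 x y z) =
  x * (a * x + b * y + c * z) + y * (d * x + e * y + f * z)
    + z * (g * x + h * y + i * z).
Proof. by rewrite /quadratic_form -mulmxA mx3_mul_vec3 vec3_dot. Qed.

Lemma pmulr_sqr_ge0 (R : realType) (c x : R) : 0 < c -> 0 <= c * x ^+ 2.
Proof. by move=> c0; rewrite pmulr_rge0// sqr_ge0. Qed.

Lemma pmulr_sqr_gt0 (R : realType) (c x : R) :
  0 < c -> x != 0 -> 0 < c * x ^+ 2.
Proof. by move=> c0 x0; rewrite pmulr_rgt0// exprn_even_gt0. Qed.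

Lemma sylvester3 (R : realType) (a b c d e f : R) :
  0 < a -> 0 < a * d - b ^+ 2 ->
  0 < a * d * f + b * c * e *+ 2 - a * e ^+ 2 - d * c ^+ 2 - f * b ^+ 2 ->
  positive_definite (mx3 [:: [:: a; b; c]; [:: b; d; e]; [:: c; e; f]]).
Proof.
set m := a * d - b ^+ 2; set D := _ - f * b ^+ 2 => a0 m0 D0 u.
have [x [y [z ->]]] := vec3P _ u; rewrite vec3_eq0 quadratic_form_vec3 => u0.
rewrite -(pmulr_rgt0 _ (mulr_gt0 a0 m0)).
(* Completion of squares, after scaling the form by the first two leading minors. The last nonzero
   coordinate then decides which square is strictly positive. *)
rewrite [ltRHS](_ : _ = m * (a * x + b * y + c * z) ^+ 2
  + (m * y + (a * e - b * c) * z) ^+ 2 + a * D * z ^+ 2); last first.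
  by rewrite /m /D; ring.
have [z0|z0] := eqVneq z 0; last first.
  rewrite ltr_wpDl ?pmulr_sqr_gt0 ?mulr_gt0//.
  by rewrite addr_ge0 ?sqr_ge0 ?pmulr_sqr_ge0.
move: u0; rewrite z0 eqxx andbT expr0n !mulr0 !addr0 => u0.
have [y0|y0] := eqVneq y 0; last first.
  by rewrite ltr_wpDl ?pmulr_sqr_ge0// exprn_even_gt0//= mulf_neq0// gt_eqF.
move: u0; rewrite y0 eqxx andbT !mulr0 expr0n !addr0 => x0.
by rewrite pmulr_sqr_gt0// mulf_neq0// gt_eqF.
Qed.

(** * Change of coordinates and Lyapunov forms of companion matrices *)

(** The form is pulled back to [T^T *m P *m T]. By the intertwining relation its Lyapunov matrix for
    [A] is the congruence by [T] of that of [P] for [B], and injectivity preserves definiteness. *)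
Lemma lyapunov_congr (R : realType) n (T A B P : 'M[R]_n) :
  (forall u : 'cV[R]_n, T *m u = 0 -> u = 0) -> T *m A = B *m T ->
  P^T = P -> positive_definite P ->
  negative_definite (P *m B + B^T *m P) ->
  quadratic_lyapunov A (fun u => quadratic_form P (T *m u)).
Proof.
move=> Tinj TA PT Ppos Bneg.
have Tneq0 (u : 'cV[R]_n) : u != 0 -> T *m u != 0.
  by apply: contra_neq; exact: Tinj.
have TE (M : 'M[R]_n) u :
    quadratic_form (T^T *m M *m T) u = quadratic_form M (T *m u).
  by rewrite /quadratic_form trmx_mul !mulmxA.
exists (T^T *m P *m T); split.
- by rewrite !trmx_mul PT trmxK mulmxA.
- by move=> u /Tneq0 /Ppos; rewrite TE.
- move=> u /Tneq0 /Bneg; rewrite -TE mulmxDr mulmxDl.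
  by rewrite !mulmxA -!(mulmxA _ B T) -TA -trmx_mul -TA trmx_mul !mulmxA.
- by move=> u; rewrite TE.
Qed.

(* The coordinates are ordered as [(xi'', xi', xi)]. *)
Definition companion3 {R : realType} (a b c : R) : 'M[R]_3 :=
  mx3 [:: [:: a; b; c]; [:: 1; 0; 0]; [:: 0; 1; 0]].

(* The quadratic form whose derivative is [chi^2 - (xi''' + n xi')^2
   - (p^2 - 2 q + 2 n) xi''^2 - (q^2 - 2 p r - n^2) xi'^2 - r^2 xi^2], where
   [chi = xi''' + p xi'' + q xi' + r xi]. *)
Definition companion_lyapunov {R : realType} (p q r n : R) : 'M[R]_3 :=
  mx3 [:: [:: p; q - n; r]; [:: q - n; p * q - r; p * r]; [:: r; p * r; q * r]].

Lemma companion_lyapunov_sym (R : realType) (p q r n : R) :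
  (companion_lyapunov p q r n)^T = companion_lyapunov p q r n.
Proof.
apply/matrixP => i j; rewrite !mxE.
by case: i => -[|[|[|//]]] ?; case: j => -[|[|[|//]]] ?.
Qed.

(** By [sylvester3]: the second and third leading minors are rewritten as positive combinations of
    [d1], [d2] and manifestly positive terms. *)
Lemma companion_lyapunov_pos (R : realType) (p q r n : R) :
  0 < p -> 0 < r -> 0 < n < q ->
  0 < p ^+ 2 - q *+ 2 + n *+ 2 -> 0 < q ^+ 2 - (p * r) *+ 2 - n ^+ 2 ->
  positive_definite (companion_lyapunov p q r n).
Proof.
move=> p0 r0 /andP[n0 nq].
set d2 := p ^+ 2 - _ + _; set d1 := q ^+ 2 - _ - _ => d20 d10.
have q0 : 0 < q by exact: lt_trans nq.
apply: sylvester3 => //.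
- rewrite [ltRHS](_ : _ = d2 * q + (d1 + (q - n) * (q + n)) / 2); last first.
    by rewrite /d2 /d1; field.
  apply: addr_gt0; first exact: mulr_gt0.
  by rewrite divr_gt0// addr_gt0// mulr_gt0 ?subr_gt0// addr_gt0.
- rewrite [ltRHS](_ : _ =
    r * (q * d1 + d2 * (q ^+ 2 + d1 + n ^+ 2) / 2 + r ^+ 2)); last first.
    by rewrite /d2 /d1; field.
  apply: mulr_gt0 => //; apply: addr_gt0; last exact: exprn_gt0.
  apply: addr_gt0; first exact: mulr_gt0.
  apply: divr_gt0 => //; apply: mulr_gt0 => //.
  by rewrite addr_gt0 ?exprn_gt0// addr_gt0 ?exprn_gt0.
Qed.

(** The sign [s] treats both modes at once: along [B] one has [chi = s * k * xi''], so [chi ^+ 2]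
    costs exactly the [k ^+ 2] subtracted in [d2]. *)
Lemma companion_lyapunov_neg (R : realType) (p q r n k s : R) :
  0 < r -> s ^+ 2 = 1 ->
  0 < p ^+ 2 - q *+ 2 + n *+ 2 - k ^+ 2 ->
  0 < q ^+ 2 - (p * r) *+ 2 - n ^+ 2 ->
  let B := companion3 (s * k - p) (- q) (- r) in
  negative_definite
    (companion_lyapunov p q r n *m B + B^T *m companion_lyapunov p q r n).
Proof.
set d2 := _ - k ^+ 2; set d1 := q ^+ 2 - _ - _ => r0 s1 d20 d10 B u.
have [x [y [z ->]]] := vec3P _ u; rewrite vec3_eq0 => u0.
rewrite quadratic_form_lyapunov mxE -!mulmxA !mx3_mul_vec3 !vec3_dot.
set x' := (s * k - p) * x - q * y - r * z.
(* The term with [1 - s ^+ 2] makes this a polynomial identity for every [s]; it vanishes because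
   [s ^+ 2 = 1]. *)
rewrite [ltLHS](_ : _ = - ((x' + n * y) ^+ 2 + (1 - s ^+ 2) * (k * x) ^+ 2
   + d2 * x ^+ 2 + d1 * y ^+ 2 + (r * z) ^+ 2)); last first.
  by rewrite /x' /d1 /d2; ring.
rewrite s1 subrr mul0r addr0 oppr_lt0 -!addrA ltr_wpDl ?sqr_ge0//.
move: u0; rewrite !negb_and => /or3P[] u0.
- by rewrite ltr_pwDl ?pmulr_sqr_gt0 ?addr_ge0 ?pmulr_sqr_ge0 ?sqr_ge0.
- by rewrite ltr_wpDl ?pmulr_sqr_ge0// ltr_pwDl ?pmulr_sqr_gt0 ?sqr_ge0.
- rewrite addrA ltr_wpDl ?addr_ge0 ?pmulr_sqr_ge0//.
  by rewrite exprn_even_gt0//= mulf_neq0// gt_eqF.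
Qed.

(** * Reduction of the two modes to companion form *)

(* With [xi] solving
   [xi''' + p xi'' + q xi' + r xi = - |y|], the solution of the system has
   [y = (alpha mu / 2) xi'']; the matrix maps [(x, y, w)] to
   [(xi'', xi', xi)], multiplied by [beta eps^2 alpha mu^2 / 2] to clear
   denominators. *)
Definition companion_coord {R : realType} (alpha beta mu gamma eps : R) :
    'M[R]_3 :=
  mx3 [:: [:: 0; beta * eps ^+ 2 * mu; 0];
          [:: - (beta * eps * mu); - (beta * gamma * eps * mu); 0];
          [:: beta * gamma * mu;
              beta * gamma ^+ 2 * mu - (1 - alpha / 2) * mu * eps;
              - (alpha / 2 * mu * eps)]].

(** The matrix is triangular up to reordering: its rows successively force [y], [x] and [w] to
    vanish. *)
Lemma companion_coord_inj (R : realType) (alpha beta mu gamma eps : R)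
    (u : 'cV[R]_3) :
  0 < alpha -> 0 < beta -> 0 < mu -> 0 < eps ->
  companion_coord alpha beta mu gamma eps *m u = 0 -> u = 0.
Proof.
move=> a0 b0 m0 e0; have [x [y [w ->]]] := vec3P _ u.
have c1 : beta * eps ^+ 2 * mu != 0 by rewrite gt_eqF// !mulr_gt0.
have c2 : - (beta * eps * mu) != 0 by rewrite oppr_eq0 gt_eqF// !mulr_gt0.
have c3 : - (alpha / 2 * mu * eps) != 0.
  by rewrite oppr_eq0 gt_eqF// !mulr_gt0 ?invr_gt0.
move=> /eqP; rewrite mx3_mul_vec3 vec3_eq0 !mul0r add0r !addr0 => /and3P[].
rewrite mulf_eq0 (negPf c1) => /eqP ->; rewrite !mulr0 !addr0.
rewrite mulf_eq0 (negPf c2) => /eqP ->; rewrite mulr0 add0r.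
rewrite mulf_eq0 (negPf c3) => /eqP ->.
by apply/eqP; rewrite vec3_eq0 eqxx.
Qed.

Lemma mx3_ext (R : realType) (A B : 'M[R]_3) :
  (forall x y z, A *m vec3 x y z = B *m vec3 x y z) -> A = B.
Proof.
move=> AB; apply/matrixP => i j.
have [x [y [z xyz]]] := vec3P _ (delta_mx j 0 : 'cV[R]_3).
have := AB x y z; rewrite -xyz -!colE => /colP /(_ i).
by rewrite !mxE.
Qed.

(** For nonnegative [y] the forcing [- |y|] equals [- k * xi''], hence the coefficient -1 before
    [k]; the other mode has the opposite sign. *)
Lemma companion_coord_Aplus (R : realType) (alpha beta mu gamma eps : R) :
  let k := alpha / 2 * mu in
  let p := beta * gamma + (1 - alpha / 2) * mu in
  let q := beta * eps + beta * gamma * mu in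
  let r := beta * eps * mu in
  let T := companion_coord alpha beta mu gamma eps in
  T *m Aplus alpha beta mu gamma eps =
  companion3 (-1 * k - p) (- q) (- r) *m T.
Proof.
move=> k p q r T; apply: mx3_ext => x y w; rewrite -!mulmxA !mx3_mul_vec3.
by congr vec3; rewrite /k /p /q /r; field.
Qed.

Lemma companion_coord_Aminus (R : realType) (alpha beta mu gamma eps : R) :
  let k := alpha / 2 * mu in
  let p := beta * gamma + (1 - alpha / 2) * mu in
  let q := beta * eps + beta * gamma * mu in
  let r := beta * eps * mu in
  let T := companion_coord alpha beta mu gamma eps in
  T *m Aminus alpha beta mu gamma eps =
  companion3 (1 * k - p) (- q) (- r) *m T.
Proof.
move=> k p q r T; apply: mx3_ext => x y w; rewrite -!mulmxA !mx3_mul_vec3.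
by congr vec3; rewrite /k /p /q /r; field.
Qed.

(** * Common Lyapunov function and stability of the system *)

Lemma common_quadratic_lyapunov (R : realType) (alpha beta mu gamma eps : R) :
  0 < beta -> 0 < mu -> 0 < gamma -> 0 < eps -> 0 < alpha < 1 ->
  eps < beta * gamma ^+ 2 / 2 ->
  has_common_quadratic_lyapunov alpha beta mu gamma eps.
Proof.
move=> b0 m0 g0 e0 /andP[a0 a1] eps_lt.
pose k := alpha / 2 * mu.
pose p := beta * gamma + (1 - alpha / 2) * mu.
pose q := beta * eps + beta * gamma * mu.
pose r := beta * eps * mu.
(* This value cancels the mixed term in [beta * gamma * mu] in [d2] below. *)
pose n := alpha / 2 * beta * gamma * mu.
pose T := companion_coord alpha beta mu gamma eps.
have bg0 : 0 < beta * gamma by rewrite mulr_gt0.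
have h0 : 0 < 1 - alpha / 2 by lra.
have p0 : 0 < p by rewrite addr_gt0// mulr_gt0.
have r0 : 0 < r by rewrite !mulr_gt0.
have n0 : 0 < n by rewrite !mulr_gt0 ?invr_gt0.
(* The upper bound on [eps], multiplied by [2 * beta]: this difference appears in both [d2] and
   [d1]. *)
have be_lt : beta * eps *+ 2 < (beta * gamma) ^+ 2.
  rewrite -subr_gt0 (_ : _ - _ = beta * 2 * (beta * gamma ^+ 2 / 2 - eps)).
    by rewrite !mulr_gt0// subr_gt0.
  by field.
have nq : n < q.
  rewrite -subr_gt0 (_ : _ - _ = beta * eps
      + (1 - alpha / 2) * (beta * gamma * mu)).
    by rewrite addr_gt0 ?mulr_gt0.
  by rewrite /q /n; ring.
have d2 : 0 < p ^+ 2 - q *+ 2 + n *+ 2 - k ^+ 2.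
  rewrite (_ : _ - _ = (beta * gamma) ^+ 2 - beta * eps *+ 2
      + (1 - alpha) * mu ^+ 2); last by rewrite /p /q /n /k; field.
  by rewrite addr_gt0 ?subr_gt0// mulr_gt0 ?subr_gt0// exprn_gt0.
have d1 : 0 < q ^+ 2 - (p * r) *+ 2 - n ^+ 2.
  rewrite (_ : _ - _ = (beta * eps) ^+ 2
      + (1 - alpha / 2) * mu ^+ 2 * ((beta * gamma) ^+ 2 - beta * eps *+ 2)
      + alpha / 2 * (1 - alpha / 2) * (beta * gamma * mu) ^+ 2); last first.
    by rewrite /p /q /r /n; field.
  apply: addr_gt0; first apply: addr_gt0.
  - by rewrite exprn_gt0// mulr_gt0.
  - by rewrite mulr_gt0 ?subr_gt0// mulr_gt0// exprn_gt0.
  - by apply: mulr_gt0; rewrite ?exprn_gt0// mulr_gt0// divr_gt0.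
have Ppos : positive_definite (companion_lyapunov p q r n).
  apply: companion_lyapunov_pos => //; first by rewrite n0.
  by apply: lt_le_trans d2 _; rewrite lerBlDr lerDl sqr_ge0.
have Tinj (u : 'cV[R]_3) : T *m u = 0 -> u = 0 by exact: companion_coord_inj.
have Psym := companion_lyapunov_sym _ p q r n.
exists (fun u => quadratic_form (companion_lyapunov p q r n) (T *m u)); split.
- apply: (lyapunov_congr _ _ _ _ _ _ Tinj
    (companion_coord_Aplus _ _ _ _ _ _)) => //.
  by apply: companion_lyapunov_neg => //; rewrite sqrrN expr1n.
- apply: (lyapunov_congr _ _ _ _ _ _ Tinj
    (companion_coord_Aminus _ _ _ _ _ _)) => //.
  by apply: companion_lyapunov_neg => //; rewrite expr1n.
Qed.

(** At each positive time the sign of [y t] selects one of the two matrices, so a solution is a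
    trajectory of the switched system handled by [common_lyapunov_exponential_decay]. *)
Lemma common_lyapunov_stable (R : realType) (alpha beta mu gamma eps : R) :
  has_common_quadratic_lyapunov alpha beta mu gamma eps ->
  exponentially_stable alpha beta mu gamma eps.
Proof.
move=> [V [VA VB]].
have [C [a [C0 a0 decay]]] := common_lyapunov_exponential_decay _ _ _ _ _ VA VB.
exists C, a; split=> // x y w [dx dy dw ode].
have coord (f g h : R -> R) (i : 'I_3) :
    (fun s => vec3 (f s) (g s) (h s) i 0) = nth f [:: f; g; h] i.
  by apply/funext => s; rewrite mxE; case: i => -[|[|[|//]]].
apply: (decay (fun s => vec3 (x s) (y s) (w s))) => [i|t t0].
  by rewrite coord; case: i => -[|[|[|//]]].
have /system_eqs_switched := ode t t0.
set M := (if _ then _ else _) => dM; exists M.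
  by rewrite /M; case: ifP; [left|right].
move=> i; rewrite -dM coord mxE; by case: i => -[|[|[|//]]].
Qed.

(** * Admissible parameters and conclusion *)

Lemma parameter_condition_ex (R : realType) (beta mu alpha : R) :
  0 < beta -> 0 < mu -> 0 < alpha < 1 ->
  exists gamma eps : R,
    [/\ 0 < gamma, 0 < eps & parameter_condition alpha beta mu gamma eps].
Proof.
move=> b0 m0 /andP[a0 a1].
(* [gamma] is taken as twice its lower threshold [g]. The parenthesis in [l2] then equals
   [alpha * g * mu / 2], so both lower bounds on [eps] lie below [u], and [eps] is the midpoint of
   the remaining interval. *)
set g := (1 - alpha) * mu / (alpha * beta).
have g0 : 0 < g by rewrite divr_gt0 ?mulr_gt0 ?subr_gt0.
set u := beta * (2 * g) ^+ 2 / 2.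
set l1 := beta * (2 * g) ^+ 2 / 4.
set l2 := u - (alpha * (2 * g) * mu / 2 - (1 - alpha) * mu ^+ 2 / (2 * beta)).
have l1_gt0 : 0 < l1 by rewrite divr_gt0// mulr_gt0// exprn_gt0// mulr_gt0.
have l1u : l1 < u.
  by rewrite -subr_gt0 (_ : u - l1 = l1) // /u /l1; field.
have l2u : l2 < u.
  rewrite /l2 ltrBlDr ltrDl (_ : _ - _ = alpha * g * mu / 2).
    by rewrite divr_gt0//; do 2 apply: mulr_gt0 => //.
  by rewrite /g; field; rewrite !gt_eqF.
have lu : Num.max l1 l2 < u by rewrite gt_max l1u.
have [{}lu ul] := midf_lt lu.
move: lu; rewrite gt_max => /andP[l1e l2e].
exists (2 * g), ((Num.max l1 l2 + u) / 2); split; first by rewrite mulr_gt0.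
  exact: lt_trans l1e.
split=> //; first by rewrite l1e.
by rewrite -/g ltr_pMl// ltr1n.
Qed.

Theorem theorem2 (R : realType) :
  (forall beta mu alpha : R,
     0 < beta -> 0 < mu -> 0 < alpha < 1 ->
     exists gamma eps : R,
       [/\ 0 < gamma, 0 < eps & parameter_condition alpha beta mu gamma eps])
  /\
  (forall alpha beta mu gamma eps : R,
     0 < beta -> 0 < mu -> 0 < gamma -> 0 < eps -> 0 < alpha < 1 ->
     parameter_condition alpha beta mu gamma eps ->
     has_common_quadratic_lyapunov alpha beta mu gamma eps /\
     exponentially_stable alpha beta mu gamma eps).
Proof.
split=> [beta mu alpha|alpha beta mu gamma eps b0 m0 g0 e0 a01].
  exact: parameter_condition_ex.
move=> [/andP[_ eps_lt] _ _].
have Vex : has_common_quadratic_lyapunov alpha beta mu gamma eps.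
  exact: common_quadratic_lyapunov.
by split=> //; exact: common_lyapunov_stable.
Qed.
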